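(* Let $1\to K\to G\to H\to 1$ be an exact sequence of groups, let $d_G$ be a left-invariant metric on $G$, and let $d_H$ be the induced (left-invariant) Hausdorff metric on $H$. Then (1) $\dim_{AN}(G,d_G)\le \dim_{AN}(K,d_G|_K)+\dim_{AN}(H,d_H)$; (2) $\operatorname{asdim}_{AN}(G,d_G)\le \operatorname{asdim}_{AN}(K,d_G|_K)+\operatorname{asdim}_{AN}(H,d_H)$; (3) $\operatorname{cdim}(G,d_G)\le \operatorname{cdim}(K,d_G|_K)+\operatorname{cdim}(H,d_H)$.
   Context: The groups are general groups (not necessarily countable). Write $\|g\|_G=d_G(1,g)$ and identify $H$ with $G/K$. The Hausdorff metric $d_H$ on $H$ induced by $d_G$ is the left-invariant metric given by the norm $\|gK\|_H=\inf\{\|gk\|_G: k\in K\}$, that is, $d_H(xK,yK)=\|x^{-1}yK\|_H$. $d_G|_K$ denotes the restriction of $d_G$ to $K$. Let $(X,d)$ be a metric space and $s>0$. An $s$-scale chain between $x,y\in X$ is a finite sequence $x=x_0,x_1,\dots,x_m=y$ in $X$ with $d(x_i,x_{i+1})<s$ for all $i$. A subset $S\subset X$ is $s$-scale connected if any two of its points can be joined by an $s$-scale chain contained in $S$; the $s$-scale connected components of a subset are its maximal $s$-scale connected subsets. An $n$-dimensional control function for $X$ is an increasing function $D_X:\mathbb{R}_+\to\mathbb{R}_+$ such that for every $s>0$ there is a cover $\{U_0,\dots,U_n\}$ of $X$ such that every $s$-scale connected component of each $U_i$ has diameter at most $D_X(s)$. Then: $\dim_{AN}(X,d)\le n$ (Assouad-Nagata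 dimension) if $X$ has an $n$-dimensional control function $D_X(s)=C\cdot s$ with $C>0$ constant; $\operatorname{asdim}_{AN}(X,d)\le n$ (asymptotic Assouad-Nagata dimension) if $X$ has an $n$-dimensional control function $D_X(s)=C\cdot s+k$ with $C>0$, $k\in\mathbb{R}$ constants; $\operatorname{cdim}(X,d)\le n$ (capacity dimension) if $X$ has an $n$-dimensional control function with $D_X(s)=C\cdot s$ in a neighborhood of $0$, i.e. for $s$ sufficiently small. Each dimension is the least such $n$ ($\infty$ if there is none). *)

(* Defs.v *)
From HB Require Import structures.
From mathcomp Require Import all_boot all_order all_algebra.
From mathcomp Require Import all_classical all_reals all_analysis.

Set Implicit Arguments.
Unset Strict Implicit.
Unset Printing Implicit Defensive.

Import Order.TTheory GRing.Theory Num.Theory.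

Local Open Scope classical_set_scope.
Local Open Scope ring_scope.

(* The groups carry several metrics, among them the quotient one, which
   separates points only when K is closed in G. So distances are explicit
   functions T -> T -> R, not metricType instances, and the dimensions below
   make sense for an arbitrary such function. *)

Section Dimension.
Context {R : realType} {T : Type}.
Implicit Types (d : T -> T -> R) (A S C U : set T) (s : R) (n : nat).

Definition is_metric d : Prop :=
  [/\ forall x y, 0 <= d x y,
      forall x y, d x y = 0 <-> x = y,
      forall x y, d x y = d y x &
      forall x y z, d x z <= d x y + d y z].

(* Only the values c 0, ..., c m matter. *)
Definition scale_chain d s S (x y : T) : Prop :=
  exists (m : nat) (c : nat -> T),
    [/\ c 0%N = x, c m = y,
        forall i, (i <= m)%N -> S (c i) &
        forall i, (i < m)%N -> d (c i) (c i.+1) < s].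

Definition scale_connected d s S : Prop :=
  forall x y, S x -> S y -> scale_chain d s S x y.

Definition scale_component d s U C : Prop :=
  [/\ C `<=` U, scale_connected d s C &
      forall C', C `<=` C' -> C' `<=` U -> scale_connected d s C' -> C' = C].

Definition diameter d A : \bar R :=
  ereal_sup [set (d p.1 p.2)%:E | p in A `*` A].

(* R_+ is the half-line of s >= 0; D is unconstrained on negative reals. *)
Definition control_function d n (D : R -> R) : Prop :=
  [/\ forall s, 0 <= s -> 0 <= D s,
      forall s t, 0 <= s -> s <= t -> D s <= D t &
      forall s, 0 < s ->
        exists U : 'I_n.+1 -> set T,
          \bigcup_i U i = [set: T] /\
          forall i C, scale_component d s (U i) C ->
            (diameter d C <= (D s)%:E)%E].

Definition dim_AN_le d n : Prop :=
  exists C : R, 0 < C /\ control_function d n (fun s => C * s).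

Definition asdim_AN_le d n : Prop :=
  exists C k : R, 0 < C /\ control_function d n (fun s => C * s + k).

Definition cdim_le d n : Prop :=
  exists (D : R -> R) (C e : R),
    [/\ control_function d n D, 0 < C, 0 < e &
        forall s, 0 < s -> s < e -> D s = C * s].

(* An infimum of natural numbers is attained, and it is +oo on the empty
   set; see least_nat_le. *)
Definition least_nat (P : nat -> Prop) : \bar R :=
  ereal_inf [set n%:R%:E | n in [set n | P n]].

Definition dim_AN d : \bar R := least_nat (dim_AN_le d).
Definition asdim_AN d : \bar R := least_nat (asdim_AN_le d).
Definition cdim d : \bar R := least_nat (cdim_le d).

Lemma least_nat_le (P : nat -> Prop) n :
  (least_nat P <= n%:R%:E)%E <-> exists2 m, (m <= n)%N & P m.
Proof.
split=> [le_n|[m le_mn Pm]]; last first.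
  apply: (@le_trans _ _ m%:R%:E); last by rewrite lee_fin ler_nat.
  by apply: ereal_inf_lbound; exists m.
apply: contrapT => nP.
suff : (n.+1%:R%:E <= least_nat P)%E.
  by move=> /le_trans/(_ le_n); rewrite lee_fin ler_nat ltnn.
apply: le_ereal_inf_tmp => _ [m Pm <-]; rewrite lee_fin ler_nat ltnNge.
by apply/negP => le_mn; apply: nP; exists m.
Qed.

End Dimension.

Definition short_exact {K G H : groupType} (iota : K -> G) (pi : G -> H) : Prop :=
  [/\ injective iota, range iota = pi @^-1` [set 1%g] & range pi = [set: H]].

Definition left_invariant {R : realType} {G : groupType} (d : G -> G -> R) : Prop :=
  forall g x y : G, d (g * x)%g (g * y)%g = d x y.

Section Extension.
Context {R : realType} {K G H : groupType}.

Definition restricted_metric (iota : K -> G) (d : G -> G -> R) (x y : K) : R :=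
  d (iota x) (iota y).

(* H plays the role of G/K: h = pi g stands for the coset gK, which is the
   fibre of pi over h. *)
Definition quotient_norm (pi : G -> H) (d : G -> G -> R) (h : H) : R :=
  inf [set d 1%g x | x in pi @^-1` [set h]].

Definition hausdorff_metric (pi : G -> H) (d : G -> G -> R) (x y : H) : R :=
  quotient_norm pi d (x^-1 * y)%g.

End Extension.

(* Main.v *)
Require Import Defs.
From HB Require Import structures.
From mathcomp Require Import all_boot all_order all_algebra.
From mathcomp Require Import all_classical all_reals all_analysis.
From mathcomp Require Import lra.

(* Let n and m bound the dimensions of K and H.  For the pseudometric
   dH (pi x) (pi y) <= dG x y on G, first find n + 1 sets covering G such that
   chains inside one set have controlled diameter as long as they stay in a
   subset whose image in H has width at most w: cover H by V_0, ..., V_m at a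
   scale larger than w, note that the preimage of a component of V_i lies close
   to a coset of K and can be covered like K, and merge the covers over
   V_0, ..., V_m one after the other at increasing scales in G, while the scale
   in H stays fixed.

   By Kolmogorov's trick these n + 1 sets become n + m + 1 sets U_i covering
   every point at least m + 1 times, and a cover of H becomes n + m + 1 sets W_i
   covering every point at least n + 1 times.  By pigeonhole the sets
   U_i `&` pi^-1 (W_i) cover G; a chain in one of them projects into a component
   of W_i, which has bounded width, so its diameter is controlled.

   All bounds are obtained from the control functions of K and H by sums and
   compositions.  The three dimensions correspond to three classes of functions
   closed under these operations. *)

Set Implicit Arguments.
Unset Strict Implicit.
Unset Printing Implicit Defensive.

Import Order.TTheory GRing.Theory Num.Theory.

Local Open Scope classical_set_scope.
Local Open Scope ring_scope.

(** * Chains in a pseudometric space *)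

Section Chains.
Context {R : realType} {T : Type} (d : T -> T -> R).
Implicit Types (r b : R) (S : set T).

(** This form also admits distances that need not separate points: the quotient distance on [H], its
    pullback to [G], the zero function. *)
Definition pseudometric : Prop :=
  [/\ forall x, d x x = 0, forall x y, d x y = d y x &
      forall x y z, d x z <= d x y + d y z].

Lemma is_metric_pseudometric : is_metric d -> pseudometric.
Proof. by case=> _ d0 dC dD; split=> // x; apply/d0. Qed.

Lemma pseudometric_ge0 x y : pseudometric -> 0 <= d x y.
Proof.
by case=> d0 dC dD; have := dD x y x; rewrite d0 (dC y x); lra.
Qed.

Lemma scale_chain_refl r S x : S x -> scale_chain d r S x x.
Proof. by move=> Sx; exists 0%N, (fun=> x); split. Qed.

Lemma scale_chain_rcons r S x y z :
  scale_chain d r S x y -> S z -> d y z < r -> scale_chain d r S x z.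
Proof.
move=> [m [c [c0 cm cS cr]]] Sz yz.
exists m.+1, (fun i => if (i <= m)%N then c i else z); split => //.
- by rewrite ltnn.
- by move=> i _; case: ifP => // /cS.
move=> i; rewrite ltnS => im; rewrite im; case: ltnP => [/cr//|mi].
by rewrite (_ : i = m) ?cm //; apply/eqP; rewrite eqn_leq im.
Qed.

Lemma scale_chain_ind r S x (Q : T -> Prop) :
  (S x -> Q x) ->
  (forall y z, scale_chain d r S x y -> Q y -> S z -> d y z < r -> Q z) ->
  forall y, scale_chain d r S x y -> Q y.
Proof.
move=> Qx Qstep _ [m [c [c0 <- cS cr]]].
have cx : S x by rewrite -c0; apply: cS.
have chain_c i : (i <= m)%N -> scale_chain d r S x (c i).
  elim: i => [_|i IH im]; first by rewrite c0; exact: scale_chain_refl.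
  by apply: scale_chain_rcons (IH (ltnW im)) _ _; [exact: cS|exact: cr].
suff: forall i, (i <= m)%N -> Q (c i) by apply.
elim=> [_|i IH im]; first by rewrite c0; exact: Qx.
apply: (Qstep (c i)); [exact/chain_c/ltnW|exact/IH/ltnW|exact: cS|exact: cr].
Qed.

Lemma scale_chain_mem r S x y : scale_chain d r S x y -> S x /\ S y.
Proof.
by move=> [m [c [<- <- cS _]]]; split; apply: cS.
Qed.

Lemma scale_chain_trans r S y x z :
  scale_chain d r S x y -> scale_chain d r S y z -> scale_chain d r S x z.
Proof.
move=> xy; move: z; apply: scale_chain_ind => // z w _; exact: scale_chain_rcons.
Qed.

Lemma scale_chain_sym r S x y : pseudometric ->
  scale_chain d r S x y -> scale_chain d r S y x.
Proof.
move=> [_ dC _]; move: y; apply: scale_chain_ind; first exact: scale_chain_refl.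
move=> y z xy yx Sz yz; have [_ Sy] := scale_chain_mem xy.
apply: scale_chain_trans yx.
by apply: scale_chain_rcons (scale_chain_refl _ Sz) Sy _; rewrite dC.
Qed.

Lemma scale_chain_reachable r S x y :
  scale_chain d r S x y ->
  scale_chain d r (S `&` [set z | scale_chain d r S x z]) x y.
Proof.
move: y; apply: scale_chain_ind => [Sx|y z xy IH Sz yz].
  by apply: scale_chain_refl; split => //=; exact: scale_chain_refl.
apply: (scale_chain_rcons IH _ yz); split => //=.
exact: scale_chain_rcons xy Sz yz.
Qed.

Definition chain_bounded r b S : Prop :=
  forall x y, scale_chain d r S x y -> d x y <= b.

End Chains.

(** With [f := id] this gives monotonicity in the set and in the scale. *)
Lemma scale_chain_map {R : realType} {T T' : Type} (d : T -> T -> R)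
    (d' : T' -> T' -> R) (f : T -> T') r r' (S : set T) (S' : set T') x y :
  (forall z, S z -> S' (f z)) ->
  (forall z w, S z -> S w -> d z w < r -> d' (f z) (f w) < r') ->
  scale_chain d r S x y -> scale_chain d' r' S' (f x) (f y).
Proof.
move=> fS fr [m [c [<- <- cS cr]]]; exists m, (f \o c); split => //=.
  by move=> i im; exact/fS/cS.
by move=> i im; apply: fr; [exact/cS/ltnW|exact: cS|exact: cr].
Qed.

(** * Diameters of components in terms of chains *)

Section ControlFunction.
Context {R : realType} {T : Type} (d : T -> T -> R).
Hypothesis d_pm : pseudometric d.

Lemma scale_chain_component r U x :
  U x -> scale_component d r U [set y | scale_chain d r U x y].
Proof.
move=> Ux; split.
- by move=> y /= xy; have [] := scale_chain_mem xy.
- move=> y z /= xy xz.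
  have yx := scale_chain_sym d_pm xy.
  have yz := scale_chain_trans yx xz.
  move: (scale_chain_reachable yz).
  apply: (@scale_chain_map _ _ _ d d id) => // w [_ /=].
  exact: scale_chain_trans.
move=> C' sub C'U conn; apply/seteqP; split => // y C'y /=.
have C'x : C' x by apply: sub => /=; exact: scale_chain_refl.
by apply: (@scale_chain_map _ _ _ d d id) (conn _ _ C'x C'y).
Qed.

(** Endpoints of a chain in [U] share a component, the set reachable from the first; conversely, a
    component is connected, so chains join its points. *)
Lemma component_diameterP r b U :
  (forall C, scale_component d r U C -> (diameter d C <= b%:E)%E) <->
  chain_bounded d r b U.
Proof.
split=> [diamC x y xy|bU C [CU Cconn _]].
  have [Ux Uy] := scale_chain_mem xy.
  rewrite -lee_fin; apply: le_trans (diamC _ (scale_chain_component r Ux)).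
  apply: ereal_sup_ubound; exists (x, y) => //; split => //=.
  exact: scale_chain_refl.
apply: ge_ereal_sup => _ [[x y] [/= Cx Cy] <-]; rewrite lee_fin; apply: bU.
by apply: (@scale_chain_map _ _ _ d d id) (Cconn _ _ Cx Cy).
Qed.

Definition scale_cover n r b : Prop :=
  exists U : nat -> set T,
    (forall x, exists2 i, (i < n)%N & U i x) /\
    forall i, (i < n)%N -> chain_bounded d r b (U i).

Lemma scale_coverP n r b :
  (exists U : 'I_n.+1 -> set T, \bigcup_i U i = [set: T] /\
     forall i C, scale_component d r (U i) C -> (diameter d C <= b%:E)%E) <->
  scale_cover n.+1 r b.
Proof.
split=> [[U [cU bU]]|[U [cU bU]]].
  exists (fun i => U (inord i)); split => [x|i _]; last first.
    by apply/component_diameterP; exact: bU.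
  have : (\bigcup_i U i) x by rewrite cU.
  by case=> i _ Ux; exists i => //; rewrite inord_val.
exists (fun i => U i); split=> [|i]; last first.
  by apply/component_diameterP; exact: bU.
apply/seteqP; split=> // x _; have [i ni Ux] := cU x.
by exists (Ordinal ni).
Qed.

Lemma control_function_scale_cover n D s :
  control_function d n D -> 0 < s -> scale_cover n.+1 s (D s).
Proof. by case=> _ _ + s0 => /(_ s s0)/scale_coverP. Qed.

Lemma scale_cover_le n r b b' :
  b <= b' -> scale_cover n r b -> scale_cover n r b'.
Proof.
move=> bb' [U [cU bU]]; exists U; split => // i ni x y xy.
exact: le_trans (bU i ni x y xy) bb'.
Qed.

End ControlFunction.

(** * Classes of growth functions and the three dimensions *)

Section Gauges.
Context {R : realType}.
Implicit Types (F G : R -> R) (P : (R -> R) -> Prop).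

Definition gauge F : Prop :=
  (forall s, 0 < s -> 0 < F s) /\
  (forall s t, 0 < s -> s <= t -> F s <= F t).

Record gauge_class P : Prop := GaugeClass {
  gauge_class_gauge : forall F, P F -> gauge F;
  gauge_class_id : P id;
  gauge_class_add : forall F G, P F -> P G -> P (fun s => F s + G s);
  gauge_class_comp : forall F G, P F -> P G -> P (fun s => G (F s)) }.

Lemma gauge_class_gt0 P F s : gauge_class P -> P F -> 0 < s -> 0 < F s.
Proof. by move=> PC /(gauge_class_gauge PC)[+ _]; exact. Qed.

Lemma gauge_class_mul P F k : gauge_class P -> P F ->
  P (fun s => F s *+ k.+1).
Proof. by move=> PC PF; elim: k => // k IH; exact: gauge_class_add. Qed.

Lemma gauge_id : gauge id.
Proof. by split. Qed.

Lemma gauge_add F G : gauge F -> gauge G -> gauge (fun s => F s + G s).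
Proof.
move=> [F0 Fm] [G0 Gm]; split=> [s s0|s t s0 st].
  by rewrite addr_gt0 ?F0 ?G0.
by rewrite lerD ?Fm ?Gm.
Qed.

Lemma gauge_comp F G : gauge F -> gauge G -> gauge (fun s => G (F s)).
Proof.
move=> [F0 Fm] [G0 Gm]; split=> [s s0|s t s0 st]; first exact/G0/F0.
by apply: Gm; [exact: F0|exact: Fm].
Qed.

Definition linear_gauge F : Prop :=
  gauge F /\ exists2 C, 0 < C & forall s, 0 < s -> F s <= C * s.

Definition affine_gauge F : Prop :=
  gauge F /\ exists C k,
    [/\ 0 < C, 0 <= k & forall s, 0 < s -> F s <= C * s + k].

Definition locally_linear_gauge F : Prop :=
  gauge F /\ exists C e,
    [/\ 0 < C, 0 < e & forall s, 0 < s -> s < e -> F s <= C * s].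

Lemma linear_gauge_class : gauge_class linear_gauge.
Proof.
split=> [F []//||F G [gF [C C0 FC]] [gG [C' C'0 GC]]
  |F G [gF [C C0 FC]] [gG [C' C'0 GC]]].
- by split; [exact: gauge_id|exists 1 => // s _; rewrite mul1r].
- split; first exact: gauge_add.
  exists (C + C'); first exact: addr_gt0.
  by move=> s s0; rewrite mulrDl lerD ?FC ?GC.
- split; first exact: gauge_comp.
  exists (C' * C); first exact: mulr_gt0.
  move=> s s0; apply: le_trans (GC _ (gF.1 _ s0)) _.
  by rewrite -mulrA ler_pM2l ?FC.
Qed.

Lemma affine_gauge_class : gauge_class affine_gauge.
Proof.
split=> [F []//||F G [gF [C [k [C0 k0 FC]]]] [gG [C' [k' [C'0 k'0 GC]]]]
  |F G [gF [C [k [C0 k0 FC]]]] [gG [C' [k' [C'0 k'0 GC]]]]].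
- by split; [exact: gauge_id|exists 1, 0; split=> // s _; rewrite mul1r addr0].
- split; first exact: gauge_add.
  exists (C + C'), (k + k'); split; [exact: addr_gt0|exact: addr_ge0|].
  by move=> s s0; have := FC _ s0; have := GC _ s0; lra.
- split; first exact: gauge_comp.
  exists (C' * C), (C' * k + k'); split; first exact: mulr_gt0.
    by rewrite addr_ge0 // mulr_ge0 // ltW.
  move=> s s0; apply: le_trans (GC _ (gF.1 _ s0)) _.
  by rewrite addrA lerD2r -mulrA -mulrDr ler_pM2l ?FC.
Qed.

Lemma locally_linear_gauge_class : gauge_class locally_linear_gauge.
Proof.
split=> [F []//||F G [gF [C [e [C0 e0 FC]]]] [gG [C' [e' [C'0 e'0 GC]]]]
  |F G [gF [C [e [C0 e0 FC]]]] [gG [C' [e' [C'0 e'0 GC]]]]].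
- by split; [exact: gauge_id|exists 1, 1; split=> // s _; rewrite mul1r].
- split; first exact: gauge_add.
  exists (C + C'), (Num.min e e'); split; first exact: addr_gt0.
    by rewrite lt_min e0.
  by move=> s s0; rewrite lt_min => /andP[se se']; rewrite mulrDl lerD ?FC ?GC.
- split; first exact: gauge_comp.
  (* [s < e' / C] forces [F s < e'], where the linear estimate for [G] holds. *)
  exists (C' * C), (Num.min e (e' / C)); split; first exact: mulr_gt0.
    by rewrite lt_min e0 divr_gt0.
  move=> s s0; rewrite lt_min ltr_pdivlMr // => /andP[se se'].
  have Fs := FC _ s0 se.
  have Fe : F s < e' by rewrite (le_lt_trans Fs) // mulrC.
  apply: le_trans (GC _ (gF.1 _ s0) Fe) _.
  by rewrite -mulrA ler_pM2l.
Qed.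

Definition gauge_cover {T : Type} (d : T -> T -> R) P n : Prop :=
  exists2 F, P F & forall s, 0 < s -> scale_cover d n.+1 s (F s).

Context {T : Type} (d : T -> T -> R).
Hypothesis d_pm : pseudometric d.

Lemma dim_AN_leP n : dim_AN_le d n <-> gauge_cover d linear_gauge n.
Proof.
split=> [[C [C0 ctl]]|[F [gF [C C0 FC]] cov]].
  exists (fun s => C * s); last first.
    by move=> s s0; exact: (control_function_scale_cover d_pm ctl s0).
  split; last by exists C.
  by split=> [s s0|s t s0 st]; rewrite ?mulr_gt0 ?ler_pM2l.
exists C; split => //; split.
- by move=> s s0; rewrite mulr_ge0 // ltW.
- by move=> s t _ st; rewrite ler_pM2l.
move=> s s0; apply/scale_coverP => //; apply: scale_cover_le (cov s s0).
exact: FC.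
Qed.

Lemma asdim_AN_leP n : asdim_AN_le d n <-> gauge_cover d affine_gauge n.
Proof.
split=> [[C [k [C0 ctl]]]|[F [gF [C [k [C0 k0 FC]]]] cov]].
  have k0 : 0 <= k by case: ctl => /(_ 0 (lexx _)); rewrite mulr0 add0r.
  exists (fun s => C * s + k); last first.
    by move=> s s0; exact: (control_function_scale_cover d_pm ctl s0).
  split; last by exists C, k.
  split=> [s s0|s t s0 st]; last by rewrite lerD2r ler_pM2l.
  by rewrite ltr_pwDl // mulr_gt0.
exists C, k; split => //; split.
- by move=> s s0; rewrite addr_ge0 // mulr_ge0 // ltW.
- by move=> s t _ st; rewrite lerD2r ler_pM2l.
move=> s s0; apply/scale_coverP => //; apply: scale_cover_le (cov s s0).
exact: FC.
Qed.

Lemma cdim_leP n : cdim_le d n <-> gauge_cover d locally_linear_gauge n.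
Proof.
split=> [[D [C [e [ctl C0 e0 DC]]]]|[F [gF [C [e [C0 e0 FC]]]] cov]].
  have [D0 Dm _] := ctl.
  exists D; last by move=> s s0; exact: (control_function_scale_cover d_pm ctl s0).
  split; last by exists C, e; split => // s s0 se; rewrite DC.
  split=> [s s0|s t s0 st]; last by rewrite Dm // ltW.
  (* By monotonicity, positivity of [D] at [s] follows from a point below [e], where [D] is
     linear. *)
  have m0 : 0 < Num.min s (e / 2) by rewrite lt_min s0 divr_gt0.
  apply: (@lt_le_trans _ _ (D (Num.min s (e / 2)))).
    rewrite DC ?mulr_gt0 // gt_min; apply/orP; right; lra.
  by apply: Dm; [exact: ltW|rewrite ge_min lexx].
(* The function must be exactly [C * s] near [0] and monotone everywhere; adding [C * s] to [F s]
   beyond [e] prevents a drop at [e]. *)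
exists (fun s => if s < e then C * s else F s + C * s), C, e; split => //.
  split.
  - move=> s s0; have Cs : 0 <= C * s by rewrite mulr_ge0 // ltW.
    case: ltP => // es; rewrite addr_ge0 // ltW //.
    exact: gF.1 (lt_le_trans e0 es).
  - move=> s t s0 st; have Cst : C * s <= C * t by rewrite ler_pM2l.
    case: ltP => se; case: ltP => te //.
    + have := gF.1 _ (lt_le_trans e0 te); lra.
    + by move: (lt_le_trans te se); rewrite ltNge st.
    + by rewrite lerD // gF.2 // (lt_le_trans e0).
  move=> s s0; apply/scale_coverP => //; apply: scale_cover_le (cov s s0).
  by case: ltP => se; [exact: FC|rewrite lerDl mulr_ge0 // ltW].
by move=> s s0 se; rewrite se.
Qed.

End Gauges.

(** * Sums of possibly infinite dimensions *)

Section LeastNat.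
Context {R : realType}.
Implicit Types P Q S : nat -> Prop.

Lemma least_nat_attained P :
  @least_nat R P = +oo%E \/ exists2 n, P n & @least_nat R P = n%:R%:E.
Proof.
have [[n Pn]|nP] := pselect (exists n, P n); last first.
  left; rewrite /least_nat (_ : [set n | P n] = set0) ?image_set0 ?ereal_inf0//.
  by rewrite -subset0 => n Pn; apply: nP; exists n.
right; have exP : exists n, `[<P n>] by exists n; apply/asboolP.
have [m /asboolP Pm min_m] := ex_minnP exP; exists m => //.
apply/eqP; rewrite eq_le; apply/andP; split.
  by apply/least_nat_le; exists m.
apply: le_ereal_inf_tmp => _ [p Pp <-]; rewrite lee_fin ler_nat.
exact/min_m/asboolP.
Qed.

(** Excludes [-oo] as the other summand when one dimension is [+oo]. *)
Lemma least_nat_ge0 P : (0 <= @least_nat R P)%E.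
Proof.
by case: (least_nat_attained P) => [->|[n _ ->]]; rewrite ?lee_fin ?ler0n.
Qed.

Lemma least_nat_add P Q S : (forall m n, P m -> Q n -> S (m + n)%N) ->
  (@least_nat R S <= @least_nat R P + @least_nat R Q)%E.
Proof.
move=> PQS.
case: (least_nat_attained P) => [->|[m Pm ->]].
  by rewrite addye ?leey// gt_eqF// (lt_le_trans _ (least_nat_ge0 Q)) ?ltNy0.
case: (least_nat_attained Q) => [->|[n Qn ->]]; first by rewrite addey ?leey.
by rewrite -EFinD -natrD; apply/least_nat_le; exists (m + n)%N => //; exact: PQS.
Qed.

End LeastNat.

(** * Relative covers, Kolmogorov's trick and unions *)

Section RelativeCovers.
Context {R : realType} {T : Type}.
Implicit Types (d e : T -> T -> R) (r w b s : R) (U V : nat -> set T).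
Implicit Types (k p : nat) (B S : set T).

Definition width_le e w B : Prop := forall x y, B x -> B y -> e x y <= w.

(** The width bound concerns a set containing the whole chain, not its single steps. For [e] zero
    and [w >= 0] this is plain [chain_bounded]. *)
Definition relatively_bounded d e r w b S : Prop :=
  forall B, width_le e w B -> chain_bounded d r b (S `&` B).

Definition multiplicity k U x : nat := (\sum_(i < k) `[< U i x >])%N.

Lemma multiplicity_gt0P k U x :
  (exists2 i, (i < k)%N & U i x) <-> (0 < multiplicity k U x)%N.
Proof.
split=> [[i ik Ux]|].
  rewrite /multiplicity (bigD1 (Ordinal ik)) //=.
  by have -> : `[< U i x >] = true by exact/asboolP.
rewrite lt0n; apply: contraNP => nU; apply/eqP/big1 => i _.
by apply/eqP; rewrite eqb0; apply/asboolPn => Ux; apply: nU; exists i.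
Qed.

Lemma multiplicity_pigeonhole k U V x :
  (k < multiplicity k U x + multiplicity k V x)%N ->
  exists2 i, (i < k)%N & U i x /\ V i x.
Proof.
move=> lt_k; apply: contrapT => nUV; move: lt_k; apply/negP; rewrite -leqNgt.
rewrite /multiplicity -big_split /=.
rewrite -[leqRHS]card_ord -sum1_card.
apply: leq_sum => i _; case: asboolP => Ui; case: asboolP => Vi //.
by case: nUV; exists i.
Qed.

Lemma leq_multiplicity k U V x y : (forall i, (i < k)%N -> U i x -> V i y) ->
  (multiplicity k U x <= multiplicity k V y)%N.
Proof.
move=> UV; apply: leq_sum => i _; case: asboolP => // Ux.
by have -> : `[< V i y >] = true by exact/asboolP/UV.
Qed.

(** An inclusion of finite index sets is an equality when the larger one has no more elements. *)
Lemma multiplicity_le_eq k U V x y : (forall i, (i < k)%N -> U i x -> V i y) ->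
  (multiplicity k V y <= multiplicity k U x)%N ->
  forall i, (i < k)%N -> V i y -> U i x.
Proof.
move=> UV + i ik Vy; apply: contraPP => nUx; apply/negP; rewrite -ltnNge.
rewrite /multiplicity (bigD1 (Ordinal ik)) // [ltnRHS](bigD1 (Ordinal ik)) //=.
have -> : `[< V i y >] = true by exact/asboolP.
have -> : `[< U i x >] = false by exact/asboolPn.
rewrite add0n add1n ltnS; apply: leq_sum => j _; case: asboolP => // Ux.
by have -> : `[< V j y >] = true by exact/asboolP/UV.
Qed.

(* Kolmogorov's trick: thicken every set by [r] and add the set of points
   whose multiplicity did not increase.  On the added set, membership in the
   [U i] is constant along [r]-chains. *)
Lemma kolmogorov_step d e r w b k p U : pseudometric d -> pseudometric e ->
  (forall x y, e x y <= d x y) -> 0 < r ->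
  (forall x, (p < multiplicity k U x)%N) ->
  (forall i, (i < k)%N -> relatively_bounded d e (r *+ 3) (w + r *+ 2) b (U i)) ->
  exists V, (forall x, (p.+1 < multiplicity k.+1 V x)%N) /\
    forall i, (i < k.+1)%N -> relatively_bounded d e r w (b + r *+ 2) (V i).
Proof.
move=> [d0 dC dD] [e0 eC eD] ed r0 pU bU.
pose N i : set T := [set x | exists2 u, U i u & d x u < r].
pose L : set T := [set x | (multiplicity k N x <= p.+1)%N].
have UN i x : U i x -> N i x by move=> Ux; exists x; rewrite ?d0.
exists (fun i => if (i < k)%N then N i else L); split=> [x|i].
  rewrite {1}/multiplicity big_ord_recr /= ltnn.
  under eq_bigr => i _ do rewrite ltn_ord.
  rewrite -/(multiplicity k N x); case: asboolP => [Lx|/negP]; last first.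
    by rewrite -ltnNge addn0.
  rewrite addn1 ltnS; apply: leq_trans (pU x) _.
  by apply: leq_multiplicity => i _; exact: UN.
rewrite ltnS leq_eqVlt => /orP[/eqP -> {i}|ik]; rewrite ?ltnn ?ik => B wB x y.
  (* The at least [p + 1] indices with [U i z] are among those with [N i z'], of which [L z'] allows
     at most [p + 1]; so the two index sets agree. *)
  have LU z z' : L z -> L z' -> d z z' < r ->
      forall i, (i < k)%N -> U i z' -> U i z.
    move=> Lz Lz' zz' i ik Uz'.
    apply: (@multiplicity_le_eq k U N z z') (UN _ _ Uz') => //.
      by move=> j _ Uz; exists z; rewrite // dC.
    exact: leq_trans Lz' (pU z).
  move=> xy; have [[Lx Bx] _] := scale_chain_mem xy.
  have /multiplicity_gt0P[i ik Ux] : (0 < multiplicity k U x)%N.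
    exact: leq_ltn_trans (pU x).
  suff : scale_chain d (r *+ 3) (U i `&` B) x y.
    move=> /bU -/(_ ik) bxy; rewrite (le_trans (bxy _)) ?lerDl ?mulrn_wge0//;
      last exact: ltW.
    by move=> u v Bu Bv; rewrite (le_trans (wB _ _ Bu Bv)) // lerDl mulrn_wge0 // ltW.
  move: y xy; apply: scale_chain_ind => [_|y z xy IH [Lz Bz] yz].
    exact: scale_chain_refl.
  have [_ [Ly By]] := scale_chain_mem xy; have [_ [Uy _]] := scale_chain_mem IH.
  apply: (scale_chain_rcons IH); last by lra.
  by split => //; apply: (LU z y) => //; rewrite dC.
(* Moving a chain from [N i] into [U i] by less than [r] keeps its steps below [3r] and, as
   [e <= d], widens [B] by at most [2r]; the two endpoints cost the final [2r]. *)
have [f fP] : exists f : T -> T, forall x, N i x -> U i (f x) /\ d x (f x) < r.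
  suff /choice[f fP] : forall x, exists u, N i x -> U i u /\ d x u < r by exists f.
  move=> z; have [[u Uu zu]|nz] := pselect (N i z); first by exists u.
  by exists z.
pose B' : set T := [set u | exists2 z, B z & d z u < r].
have wB' : width_le e (w + r *+ 2) B'.
  move=> u v [z Bz zu] [z' Bz' z'v].
  have := wB _ _ Bz Bz'; have := eD u z v; have := eD z z' v.
  have := ed z u; have := ed z' v; rewrite (eC z u); lra.
move=> xy; have [[Nx _] [Ny _]] := scale_chain_mem xy.
have : d (f x) (f y) <= b.
  apply: (bU i ik B' wB'); move: xy.
  apply: (scale_chain_map (f := f)) => [z [/fP[Uz zz] Bz]|z z'].
    by split => //; exists z.
  move=> [/fP[_ zz] _] [/fP[_ zz'] _] dzz'.
  have := dD (f z) z (f z'); have := dD z z' (f z'); rewrite (dC (f z) z); lra.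
have := (fP x Nx).2; have := (fP y Ny).2.
have := dD x (f x) y; have := dD (f x) (f y) y; rewrite (dC (f y) y); lra.
Qed.

(** Scale and width are gauges of one parameter [s], so the bound is again a function of [s] alone
    and can lie in [P]. *)
Definition relative_gauge_cover d e (P : (R -> R) -> Prop) k p : Prop :=
  forall r w : R -> R, P r -> P w -> exists2 F, P F & forall s, 0 < s ->
    exists U, (forall x, (p < multiplicity k U x)%N) /\
      forall i, (i < k)%N -> relatively_bounded d e (r s) (w s) (F s) (U i).

Lemma kolmogorov d e P k p q : gauge_class P ->
  pseudometric d -> pseudometric e -> (forall x y, e x y <= d x y) ->
  relative_gauge_cover d e P k p ->
  relative_gauge_cover d e P (k + q)%N (p + q)%N.
Proof.
move=> PC d_pm e_pm ed cov; elim: q => [|q IH]; first by rewrite !addn0.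
rewrite !addnS => r w Pr Pw.
(* [gauge_class_mul k] multiplies by [k + 1]: this is scale [3r] and width [w + 2r], as
   [kolmogorov_step] demands. *)
have [F PF FU] := IH _ _ (gauge_class_mul 2 PC Pr)
  (gauge_class_add PC Pw (gauge_class_mul 1 PC Pr)).
exists (fun s => F s + r s *+ 2) => [|s s0].
  exact: (gauge_class_add PC PF (gauge_class_mul 1 PC Pr)).
have [U [mU bU]] := FU s s0.
exact: (kolmogorov_step d_pm e_pm ed (gauge_class_gt0 PC Pr s0) mU bU).
Qed.

(** An excursion through [S] moves by at most [b], and entering and leaving it cost less than [r]
    each, so the points visited in [S'] form a chain of scale [2r + b]. The parts before the first
    and after the last of them add at most [r + b] each. *)
Lemma chain_bounded_setU d r b b' (S S' : set T) : pseudometric d -> 0 < r ->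
  chain_bounded d r b S -> chain_bounded d (r *+ 2 + b) b' S' -> 0 <= b -> 0 <= b' ->
  chain_bounded d r (b' + (r + b) *+ 2) (S `|` S').
Proof.
move=> d_pm r0 bS bS' b0 b'0 x y; have [d0 dC dD] := d_pm.
suff Q : scale_chain d r (S `|` S') x y -> scale_chain d r S x y \/
    exists t t', [/\ d x t <= r + b, scale_chain d (r *+ 2 + b) S' t t' &
      y = t' \/ exists2 u, scale_chain d r S u y & d t' u < r].
  move=> /Q[/bS|[t [t' [xt /bS' tt' t'y]]]]; first by lra.
  have : d t' y <= r + b.
    case: t'y => [->|[u /bS uy t'u]]; first by rewrite d0; lra.
    by have := dD t' u y; lra.
  by have := dD x t y; have := dD t t' y; lra.
move: y; apply: scale_chain_ind => [[Sx|S'x]|y z _ Qy [Sz|S'z] yz].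
- by left; exact: scale_chain_refl.
- right; exists x, x; split; [by rewrite d0; lra|exact: scale_chain_refl|by left].
- case: Qy => [xy|[t [t' [xt tt' t'y]]]].
    by left; exact: (scale_chain_rcons xy Sz yz).
  right; exists t, t'; split=> //; right; case: t'y => [<-|[u uy t'u]].
    by exists z => //; exact: scale_chain_refl.
  by exists u => //; exact: (scale_chain_rcons uy Sz yz).
- right; case: Qy => [/bS xy|[t [t' [xt tt' t'y]]]].
    exists z, z; split; [|exact: scale_chain_refl|by left].
    by have := dD x y z; lra.
  exists t, z; split => //; last by left.
  apply: (scale_chain_rcons tt' S'z); case: t'y => [<-|[u /bS uy t'u]]; first by lra.
  by have := dD t' u z; have := dD u y z; lra.
Qed.

End RelativeCovers.

Lemma gmulfVM {G H : groupType} (f : {multiplicative G -> H}) x y :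
  f (x^-1 * y)%g = ((f x)^-1 * f y)%g.
Proof. by apply: (mulgI (f x)); rewrite -gmulfM !mulVKg. Qed.

(** * The quotient distance on [H] and covers of [G] *)

Section LeftInvariant.
Context {R : realType} {K G H : groupType}.
Context {iota : {multiplicative K -> G} } { pi : {multiplicative G -> H} }.
Context {dG : G -> G -> R}.
Hypotheses (exact_iota_pi : short_exact iota pi) (metric_dG : is_metric dG).
Hypothesis invariant_dG : left_invariant dG.

Let dK := restricted_metric iota dG.
Let dH := hausdorff_metric pi dG.

Lemma hausdorff_metric_le x y : dH (pi x) (pi y) <= dG x y.
Proof.
have [dG0 _ _ _] := metric_dG.
rewrite -(invariant_dG x^-1)%g mulVg; apply: ge_inf.
  by exists 0 => _ [z _ <-].
by exists (x^-1 * y)%g => //=; rewrite gmulfVM.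
Qed.

Lemma hausdorff_metric_lift x h r :
  dH (pi x) h < r -> exists2 y, pi y = h & dG x y < r.
Proof.
have [_ _ pi_surj] := exact_iota_pi.
move=> /inf_lt[|_ [z /= zP <-] zr].
  have : range pi ((pi x)^-1 * h)%g by rewrite pi_surj.
  by move=> [z _ zP]; exists (dG 1%g z), z.
exists (x * z)%g; first by rewrite gmulfM zP mulVKg.
by rewrite -(invariant_dG x^-1)%g mulVg mulKg.
Qed.

Lemma pi_surjective h : exists g, pi g = h.
Proof.
have [_ _ pi_surj] := exact_iota_pi.
by have : range pi h by [rewrite pi_surj]; move=> [g _ <-]; exists g.
Qed.

(** Symmetry and the triangle inequality come from [G]: distances lift with an arbitrarily small
    loss [e], since the infimum need not be attained, and projecting back does not increase them. *)
Lemma hausdorff_metric_pseudometric : pseudometric dH.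
Proof.
have [dG0 dGeq dGC dGD] := metric_dG.
have dH0 x y : 0 <= dH x y.
  have [g <-] := pi_surjective x; have [g' <-] := pi_surjective y.
  apply: lb_le_inf; last by move=> _ [z _ <-].
  by exists (dG 1 (g^-1 * g'))%g, (g^-1 * g')%g => //=; rewrite gmulfVM.
have dHC x y : dH x y <= dH y x.
  apply/ler_addgt0Pr => e e0; have [g gy] := pi_surjective y.
  have : dH (pi g) x < dH y x + e by rewrite gy; lra.
  move=> /hausdorff_metric_lift[g' <- gg'].
  have := hausdorff_metric_le g' g; rewrite gy dGC; lra.
split.
- move=> x; have [g <-] := pi_surjective x.
  apply/eqP; rewrite eq_le dH0 andbT (le_trans (hausdorff_metric_le g g)) //.
  by rewrite (dGeq g g).2.
- by move=> x y; apply/eqP; rewrite eq_le !dHC.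
move=> x y z; apply/ler_addgt0Pr => e e0; have [g gx] := pi_surjective x.
have : dH (pi g) y < dH x y + e / 2 by rewrite gx; lra.
move=> /hausdorff_metric_lift[g' g'y gg'].
have : dH (pi g') z < dH y z + e / 2 by rewrite g'y; lra.
move=> /hausdorff_metric_lift[g'' g''z g'g''].
have := hausdorff_metric_le g g''; have := dGD g g' g''.
by rewrite gx g''z; lra.
Qed.

Lemma restricted_metric_pseudometric : pseudometric dK.
Proof.
have [dG0 dGeq dGC dGD] := metric_dG.
by split=> *; rewrite /dK /restricted_metric //; apply/dGeq.
Qed.

Let pull (x y : G) := dH (pi x) (pi y).

Lemma pull_pseudometric : pseudometric pull.
Proof.
have [dH0 dHC dHD] := hausdorff_metric_pseudometric.
by split=> *; rewrite /pull //.
Qed.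

(* The preimage of an [s]-component of [V] is within [2b] of a coset of [K], and
   the cover [U] of [K] is transported to that coset.  A set of width at most
   [w < s] for [pull] meets only one such preimage over [V]. *)
Lemma fibre_cover n r w s b t (V : set H) (U : nat -> set K) :
  0 < b -> w < s -> chain_bounded dH s b V ->
  (forall k, exists2 j, (j < n)%N & U j k) ->
  (forall j, (j < n)%N -> chain_bounded dK (r + b *+ 4) t (U j)) ->
  exists A : nat -> set G,
    (forall x, V (pi x) -> exists2 j, (j < n)%N & A j x) /\
    forall j, (j < n)%N -> relatively_bounded dG pull r w (t + b *+ 4) (A j).
Proof.
move=> b0 ws bV cU bU; have [_ _ dGC dGD] := metric_dG.
have [_ ker_pi _] := exact_iota_pi.
have [sec secK] := choice pi_surjective.
pose comp h := [set h' | scale_chain dH s V h h'].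
(* One base point per component of [V]; the default is taken only outside [V], where [comp h] is
   empty. *)
pose c h := xget 1%g (comp h).
have cP h : V h -> scale_chain dH s V h (c h).
  by move=> Vh; apply: (@xgetPex _ _ (comp h)); exists h; exact: scale_chain_refl.
have c_eq h h' : V h -> V h' -> dH h h' < s -> c h = c h'.
  move=> Vh Vh' hh'.
  have ch : scale_chain dH s V h h'.
    exact: scale_chain_rcons (scale_chain_refl _ _ Vh) Vh' hh'.
  have comp_eq : comp h = comp h'.
    apply/seteqP; split => z /=; last exact: (scale_chain_trans ch).
    apply: scale_chain_trans.
    exact: (scale_chain_sym hausdorff_metric_pseudometric ch).
  by rewrite /c comp_eq.
(* [f x] is the coordinate in [K] of a point near [x] in the coset over the base point. Lifting
   needs a strict inequality, hence [2b] instead of [b]. *)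
have /choice[f fP] : forall x, exists k,
    V (pi x) -> dG x (sec (c (pi x)) * iota k)%g < b *+ 2.
  move=> x; have [Vx|nVx] := pselect (V (pi x)); last by exists 1%g.
  have : dH (pi x) (c (pi x)) < b *+ 2 by have := bV _ _ (cP _ Vx); lra.
  move=> /hausdorff_metric_lift[y yc xy].
  have : (pi @^-1` [set 1%g]) ((sec (c (pi x)))^-1 * y)%g.
    by rewrite /= gmulfVM secK yc mulVg.
  by rewrite -ker_pi => -[k _ kP]; exists k; rewrite kP mulVKg.
exists (fun j => [set x | V (pi x) /\ U j (f x)]); split=> [x Vx|j jn B wB x y].
  by have [j jn Uj] := cU (f x); exists j.
move=> xy; have [[[Vx _] Bx] [[Vy _] By]] := scale_chain_mem xy.
(* On [B] the base point is constant and translation by its lift is an isometry, so [f] distorts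
   distances by at most [2b] at each end. *)
have close z z' : V (pi z) -> V (pi z') -> B z -> B z' ->
    `|dK (f z) (f z') - dG z z'| <= b *+ 4.
  move=> Vz Vz' Bz Bz'.
  have := fP z Vz; have := fP z' Vz'.
  rewrite -(@c_eq (pi z) (pi z')) //; last first.
    by apply: le_lt_trans ws; exact: wB.
  rewrite /dK /restricted_metric -(invariant_dG (sec (c (pi z))) (iota (f z))).
  set u := (_ * iota (f z))%g; set u' := (_ * iota (f z'))%g => z'u' zu.
  have := dGD u z u'; have := dGD z z' u'; have := dGD z u z'.
  have := dGD u u' z'; have := dGD u z u'; rewrite (dGC u z) (dGC u' z').
  by move=> *; rewrite ler_distl; apply/andP; split; lra.
have : dK (f x) (f y) <= t.
  apply: (bU j jn); move: xy; apply: scale_chain_map => [z [[]]//|].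
  move=> z z' [[Vz _] Bz] [[Vz' _] Bz'] zz'.
  by have := close _ _ Vz Vz' Bz Bz'; rewrite ler_distl => /andP[]; lra.
by have := close _ _ Vx Vy Bx By; rewrite ler_distl => /andP[]; lra.
Qed.

(** Induction on [l]: if the first [l] sets have bound [F] at scale [r], the union needs the next
    one at scale [2r + F], to which [fibre_cover] adds [4b]. The scale [2w] in [H] provides the
    strict inequality required there. *)
Lemma fibre_cover_union P n b : gauge_class P -> P b ->
  gauge_cover dK P n -> forall l r w, P r -> P w ->
  exists2 F, P F & forall s, 0 < s -> forall V : nat -> set H,
    (forall i, (i < l)%N -> chain_bounded dH (w s *+ 2) (b s) (V i)) ->
    exists A : nat -> set G,
      (forall x i, (i < l)%N -> V i (pi x) -> exists2 j, (j < n.+1)%N & A j x) /\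
      forall j, (j < n.+1)%N -> relatively_bounded dG pull (r s) (w s) (F s) (A j).
Proof.
move=> PC Pb [D PD covK]; have dG_pm := is_metric_pseudometric metric_dG.
elim=> [|l IH] r w Pr Pw.
  exists id => [|s s0 V _]; first exact: gauge_class_id.
  by exists (fun=> set0); split=> // j _ B _ x y xy; have [[]] := scale_chain_mem xy.
have [F PF FA] := IH r w Pr Pw.
pose r' s := r s *+ 2 + F s.
have Pr' : P r' by apply: gauge_class_add PF => //; exact: (gauge_class_mul 1%N PC Pr).
pose r'' s := r' s + b s *+ 4.
have Pr'' : P r''.
  by apply: gauge_class_add Pr' _ => //; exact: (gauge_class_mul 3 PC Pb).
pose F' s := D (r'' s) + b s *+ 4.
have PF' : P F'.
  apply: gauge_class_add => //; first exact: (gauge_class_comp PC Pr'' PD).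
  exact: (gauge_class_mul 3 PC Pb).
exists (fun s => F' s + (r s + F s) *+ 2) => [|s s0 V bV].
  apply: gauge_class_add => //.
  exact: (gauge_class_mul 1 PC (gauge_class_add PC Pr PF)).
have pos Q : P Q -> 0 < Q s by move=> PQ; exact: (gauge_class_gt0 PC PQ s0).
have [A [cA bA]] := FA s s0 V (fun i il => bV i (leqW il)).
have [U [cU bU]] := covK _ (pos _ Pr'').
have w_lt : w s < w s *+ 2 by rewrite mulr2n ltrDl pos.
have [A' [cA' bA']] := fibre_cover (pos _ Pb) w_lt (bV l (ltnSn l)) cU bU.
exists (fun j => A j `|` A' j); split=> [x i|j jn B wB].
  rewrite ltnS leq_eqVlt => /orP[/eqP ->|il] Vx.
    by have [j jn Aj] := cA' x Vx; exists j => //; right.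
  by have [j jn Aj] := cA x i il Vx; exists j => //; left.
rewrite setIUl; apply: chain_bounded_setU => //; first exact: pos.
- exact: bA.
- exact: bA'.
- exact/ltW/pos.
- exact/ltW/pos.
Qed.

Lemma fibre_relative_cover P n m : gauge_class P ->
  gauge_cover dK P n -> gauge_cover dH P m ->
  relative_gauge_cover dG pull P n.+1 0.
Proof.
move=> PC covK [D PD covH] r w Pr Pw.
have Pw2 := gauge_class_mul 1 PC Pw.
have [F PF FA] := fibre_cover_union PC (gauge_class_comp PC Pw2 PD) covK m.+1 Pr Pw.
exists F => // s s0.
have [V [cV bV]] := covH _ (gauge_class_gt0 PC Pw2 s0).
have [A [cA bA]] := FA s s0 V bV; exists A; split => // x.
by apply/multiplicity_gt0P; have [i im Vi] := cV (pi x); exact: cA im Vi.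
Qed.

(** With the zero function every set has width at most [w] once [w >= 0], so [kolmogorov] also
    serves for ordinary covers, here of [H]. *)
Lemma gauge_cover_relative P (T : Type) (d : T -> T -> R) m : gauge_class P ->
  gauge_cover d P m -> relative_gauge_cover d (fun _ _ => 0) P m.+1 0.
Proof.
move=> PC [D PD cov] r w Pr _.
exists (fun s => D (r s)) => [|s s0]; first exact: (gauge_class_comp PC Pr PD).
have [U [cU bU]] := cov _ (gauge_class_gt0 PC Pr s0).
exists U; split=> [x|i im B _ x y xy]; first exact/multiplicity_gt0P/cU.
apply: (bU i im); move: xy.
by apply: (@scale_chain_map _ _ _ d d id) => // z [].
Qed.

Lemma gauge_cover_extension P n m : gauge_class P ->
  gauge_cover dK P n -> gauge_cover dH P m -> gauge_cover dG P (n + m).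
Proof.
move=> PC covK covH.
have dG_pm := is_metric_pseudometric metric_dG.
have dH_pm := hausdorff_metric_pseudometric.
have Pid := gauge_class_id PC.
have zero_pm : pseudometric (fun _ _ : H => 0 : R) by split=> // *; rewrite addr0.
have dH0 x y : 0 <= dH x y by exact: pseudometric_ge0.
have [FH PFH covH'] := kolmogorov n PC dH_pm zero_pm dH0
  (gauge_cover_relative PC covH) Pid Pid.
have [F PF covG] := kolmogorov m PC dG_pm pull_pseudometric hausdorff_metric_le
  (fibre_relative_cover PC covK covH) Pid PFH.
exists F => // s s0.
have [V [mV bV]] := covH' s s0; have [U [mU bU]] := covG s s0.
rewrite addSn add0n addnC in mV bV; rewrite addSn add0n in mU bU.
exists (fun i => U i `&` pi @^-1` V i); split=> [x|i ik x y xy].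
  (* The multiplicities are at least [m + 1] and [n + 1], one more in total than the [n + m + 1]
     indices. *)
  apply: (@multiplicity_pigeonhole _ _ U (fun i => pi @^-1` V i)).
  by rewrite (leq_trans _ (leq_add (mU x) (mV (pi x)))) // addSn addnS addnC.
have bVi : chain_bounded dH s (FH s) (V i).
  have := bV i ik setT; rewrite setIT; apply => u v _ _; exact: ltW.
(* The points reachable from [x] project into one component of [V i], so [FH s] bounds the width of
   [B]. *)
pose B := [set z | scale_chain dG s (U i `&` pi @^-1` V i) x z].
apply: (bU i ik B) => [u v xu xv|].
  apply: bVi.
  have : scale_chain dG s (U i `&` pi @^-1` V i) u v.
    exact: scale_chain_trans (scale_chain_sym dG_pm xu) xv.
  apply: scale_chain_map => [z []//|z z' _ _].
  exact: le_lt_trans (hausdorff_metric_le z z').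
move: (scale_chain_reachable xy).
by apply: (@scale_chain_map _ _ _ dG dG id) => // z [[]].
Qed.

End LeftInvariant.

Theorem proposition3p5 (R : realType) (K G H : groupType)
    (iota : {multiplicative K -> G}) (pi : {multiplicative G -> H})
    (dG : G -> G -> R) :
  short_exact iota pi ->
  is_metric dG ->
  left_invariant dG ->
  let dK := restricted_metric iota dG in
  let dH := hausdorff_metric pi dG in
  [/\ (dim_AN dG <= dim_AN dK + dim_AN dH)%E,
      (asdim_AN dG <= asdim_AN dK + asdim_AN dH)%E &
      (cdim dG <= cdim dK + cdim dH)%E].
Proof.
move=> ex_iota_pi metric_dG inv_dG dK dH.
have dG_pm := is_metric_pseudometric metric_dG.
have dK_pm : pseudometric dK := restricted_metric_pseudometric metric_dG.
have dH_pm : pseudometric dH :=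
  hausdorff_metric_pseudometric ex_iota_pi metric_dG inv_dG.
have ext P := @gauge_cover_extension _ _ _ _ _ _ _ ex_iota_pi metric_dG inv_dG P.
split; apply: least_nat_add => n m.
- move=> /(dim_AN_leP dK_pm) nK /(dim_AN_leP dH_pm) mH; apply/dim_AN_leP => //.
  exact: ext linear_gauge_class nK mH.
- move=> /(asdim_AN_leP dK_pm) nK /(asdim_AN_leP dH_pm) mH.
  by apply/asdim_AN_leP => //; exact: ext affine_gauge_class nK mH.
- move=> /(cdim_leP dK_pm) nK /(cdim_leP dH_pm) mH; apply/cdim_leP => //.
  exact: ext locally_linear_gauge_class nK mH.
Qed.
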